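(* Let $A(z)$ and $B(z)$ be two $n\times n$ matrix valued meromorphic functions in $\mathbb{C}$, both holomorphic at $0$, such that $\det A(0)\neq 0$ and $\det B(0)\neq 0$. Then there exists an $n\times n$ matrix valued entire function $P(z)$ of canonical product form such that $$\tilde A(z)=P(z)A(z)\qquad\text{and}\qquad \tilde B(z)=P(z)B(z)$$ are both $n\times n$ matrix valued entire functions.
   Context: A matrix valued function is meromorphic (entire) if all its entries are meromorphic (entire). An $n\times n$ matrix valued entire function $P(z)$ is said to be of canonical product form if there are a sequence $\{P_k\}_{k\ge1}$ of $n\times n$ orthogonal projection matrices (the zero matrix is allowed) and a sequence $\{z_k\}_{k\ge 1}$ of nonzero complex numbers with $|z_k|\to\infty$ such that $$P(z)=\lim_{k\to\infty}\exp\Big(\frac{z}{z_k}P_k+\frac12\frac{z^2}{z_k^2}P_k+\cdots+\frac1k\frac{z^k}{z_k^k}P_k\Big)\Big(I_n-\frac{z}{z_k}P_k\Big)\cdots\exp\Big(\frac{z}{z_1}P_1\Big)\Big(I_n-\frac{z}{z_1}P_1\Big),$$ where the $j$-th factor is $\exp\big(\sum_{l=1}^{j}\frac1l\frac{z^l}{z_j^l}P_j\big)\big(I_n-\frac{z}{z_j}P_j\big)$ and factors with larger index stand to the left. The limit is uniform on bounded sets in operator norm. Finite products, and the empty product $I_n$, are included (take $P_k=0$ for the remaining indices). *)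

(* Defs.v *)
From HB Require Import structures.
From mathcomp Require Import all_boot all_order all_algebra.
From mathcomp Require Import complex.
From mathcomp Require Import all_classical all_reals all_analysis.

Set Implicit Arguments.
Unset Strict Implicit.
Unset Printing Implicit Defensive.

Import Order.TTheory GRing.Theory Num.Theory numFieldNormedType.Exports.

Local Open Scope classical_set_scope.
Local Open Scope ring_scope.
Local Open Scope complex_scope.

(* The complex numbers are R[i] for R : realType. MathComp-Analysis puts the
   topology of the modulus on F^o for a numFieldType F; it is transported here
   to R[i] itself, so that derivable over the scalar field R[i] is complex
   differentiability. *)
HB.instance Definition _ (R : realType) :=
  NormedModule.copy R[i] (R[i] : numClosedFieldType)^o.

Section MeromorphicFunctions.
Context {R : realType}.
Implicit Types (f : R[i] -> R[i]) (a : R[i]).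

Definition holomorphic_at f a := \forall z \near a, derivable f z 1.

Definition entire f := forall a, derivable f a 1.

Definition pole_at f a := exists (m : nat) (g : R[i] -> R[i]),
  [/\ holomorphic_at g a, g a != 0 &
      \forall z \near a^', f z = g z / (z - a) ^+ m.+1].

(* A meromorphic function is represented by a total function whose value at a
   pole is irrelevant; identities between meromorphic functions are therefore
   only meaningful at points of holomorphy. *)
Definition meromorphic f := forall a, holomorphic_at f a \/ pole_at f a.

End MeromorphicFunctions.

Section MatrixFunctions.
Context {R : realType} {n : nat}.
Implicit Types (A : R[i] -> 'M[R[i]]_n) (a : R[i]).

Definition mx_holomorphic_at A a :=
  forall i j, holomorphic_at (fun z => A z i j) a.

Definition mx_entire A := forall i j, entire (fun z => A z i j).

Definition mx_meromorphic A := forall i j, meromorphic (fun z => A z i j).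

End MatrixFunctions.

Section CanonicalProducts.
Context {R : realType} {n : nat}.

Definition eucl_norm (v : 'cV[R[i]]_n) : R :=
  Num.sqrt (\sum_i ComplexField.Normc.normc (v i 0) ^+ 2).

Definition op_norm (M : 'M[R[i]]_n) : R :=
  sup [set eucl_norm (M *m v) | v in [set v | eucl_norm v <= 1]].

Definition orthogonal_projection (Q : 'M[R[i]]_n) :=
  Q *m Q = Q /\ Q \is hermsymmx.

Definition expmx (M : 'M[R[i]]_n) : 'M[R[i]]_n :=
  limn (series (fun k => (k`!%:R : R[i])^-1 *: M ^+ k)).

Definition canonical_factor (j : nat) (a : R[i]) (Q : 'M[R[i]]_n) (z : R[i])
    : 'M[R[i]]_n :=
  expmx (\sum_(1 <= l < j.+1) (l%:R^-1 * (z ^+ l / a ^+ l)) *: Q)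
    *m (1%:M - (z / a) *: Q).

(* Sequences are indexed from 0: zs k and Qs k are the (k+1)-st zero and
   projection, hence the exponent of degree k.+1. *)
Fixpoint canonical_partial_product (zs : nat -> R[i]) (Qs : nat -> 'M[R[i]]_n)
    (k : nat) (z : R[i]) : 'M[R[i]]_n :=
  if k is k'.+1 then
    canonical_factor k'.+1 (zs k') (Qs k') z
      *m canonical_partial_product zs Qs k' z
  else 1%:M.

Definition converges_uniformly_on_bounded_sets
    (F : nat -> R[i] -> 'M[R[i]]_n) (P : R[i] -> 'M[R[i]]_n) :=
  forall B : set R[i], bounded_set B -> forall e : R, 0 < e ->
    \forall k \near \oo, forall z, B z -> op_norm (F k z - P z) < e.

Definition canonical_product_form (P : R[i] -> 'M[R[i]]_n) :=
  mx_entire P /\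
  exists (Qs : nat -> 'M[R[i]]_n) (zs : nat -> R[i]),
    [/\ forall k, orthogonal_projection (Qs k),
        forall k, zs k != 0,
        `|zs k| @[k --> \oo] --> +oo &
        converges_uniformly_on_bounded_sets
          (canonical_partial_product zs Qs) P].

End CanonicalProducts.

(* Main.v *)
(* Scalar matrices suffice. The identity is an orthogonal projection, and with
   all projections equal to it the canonical product is [p(z) I] for the scalar
   Weierstrass product [p] of the factors [E_k(z/z_k)]. So it is enough to list
   all poles of the entries of [A] and [B], each with at least its multiplicity
   (superfluous zeros do no harm), in a sequence tending to infinity.

   That [p] is entire is obtained without Cauchy's theory: if functions and
   their derivatives both converge geometrically on every disc, the mean value
   inequality shows that the limit of the derivatives is the derivative of the
   limit. The identity [E_k'(u) = - u^k exp(u + ... + u^k/k)] supplies the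
   bounds, and splitting off finitely many factors exhibits the zeros of [p]. *)
Require Import Defs.
From mathcomp Require Import all_boot all_order all_algebra.
From mathcomp Require Import complex ring lra.
From mathcomp Require Import all_classical all_reals all_analysis.

Set Implicit Arguments.
Unset Strict Implicit.
Unset Printing Implicit Defensive.

Import Order.TTheory GRing.Theory Num.Theory numFieldNormedType.Exports.
Import ComplexField.Normc.

Local Open Scope classical_set_scope.
Local Open Scope ring_scope.
Local Open Scope complex_scope.

(** * Real-valued modulus, first-order expansions, mean value inequality *)

Section Modulus.
Context {R : realType}.
Implicit Types (a z w : R[i]) (f g : R[i] -> R[i]).

Lemma normr_normc z : `|z| = (normc z)%:C.
Proof. by []. Qed.

Lemma normc_ge0 z : 0 <= normc z.
Proof. by case: z => x y; exact: sqrtr_ge0. Qed.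

Lemma ler_normcD z w : normc (z + w) <= normc z + normc w.
Proof. exact: le_normcD. Qed.

Lemma normc_opp z : normc (- z) = normc z.
Proof. exact: normcN. Qed.

Lemma normc_distC z w : normc (z - w) = normc (w - z).
Proof. by rewrite -normc_opp opprB. Qed.

Lemma ler_normcB z w : normc (z - w) <= normc z + normc w.
Proof. by rewrite -(normc_opp w) ler_normcD. Qed.

Lemma normcX z k : normc (z ^+ k) = normc z ^+ k.
Proof.
by elim: k => [|k IH]; rewrite ?expr0 ?normc1// !exprS normcM IH.
Qed.

Lemma normc_real (x : R) : normc x%:C = `|x|.
Proof. by rewrite /= expr0n /= addr0 sqrtr_sqr. Qed.

Lemma normc_nat k : normc (k%:R : R[i]) = k%:R.
Proof. by rewrite -(rmorph_nat (real_complex R)) normc_real ger0_norm. Qed.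

Lemma normc_eq0 z : (normc z == 0) = (z == 0).
Proof.
by apply/eqP/eqP => [/eq0_normc//|->]; exact: normc0.
Qed.

Lemma normc_gt0 z : (0 < normc z) = (z != 0).
Proof. by rewrite lt_def normc_ge0 normc_eq0 andbT. Qed.

Lemma normc_Re z : `|complex.Re z| <= normc z.
Proof.
by rewrite -lecR; exact: normc_ge_Re.
Qed.

Lemma normc_Im z : `|complex.Im z| <= normc z.
Proof.
case: z => x y /=; rewrite -sqrtr_sqr ler_sqrt ?addr_ge0 ?sqr_ge0//.
by rewrite lerDr sqr_ge0.
Qed.

Lemma normc_ReIm z : normc z <= `|complex.Re z| + `|complex.Im z|.
Proof.
case: z => x y /=.
rewrite -(@ger0_norm _ (`|x| + `|y|)) ?addr_ge0// -sqrtr_sqr.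
rewrite ler_sqrt ?sqr_ge0// sqrrD !real_normK ?num_real//.
by rewrite lerD2r lerDl mulrn_wge0// mulr_ge0.
Qed.

(** Positive elements of [R[i]] have zero imaginary part, so radii can be taken in [R], where the
    order is total. *)
Lemma nbhs_normcP a (P : set R[i]) :
  nbhs a P <-> exists2 e : R, 0 < e & forall z, normc (z - a) < e -> P z.
Proof.
split=> [/nbhs_normP [e /= e0 eP]|[e e0 eP]].
  move: e0 eP; case: e => x y; rewrite ltcE /= => /andP[/eqP -> x0] eP.
  by exists x => // z za; apply: eP; rewrite /= distrC normr_normc ltcR.
apply/nbhs_normP; exists e%:C; first by rewrite /= ltcR.
by move=> z; rewrite /= distrC normr_normc ltcR; exact: eP.
Qed.

Lemma dnbhs_normcP a (P : set R[i]) : (\forall z \near a^', P z) <->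
  exists2 e : R, 0 < e & forall z, z != a -> normc (z - a) < e -> P z.
Proof.
rewrite near_withinE; split.
  by move=> /nbhs_normcP[e e0 eP]; exists e => // z za zae; exact: eP.
by move=> [e e0 eP]; apply/nbhs_normcP; exists e => // z zae za; exact: eP.
Qed.

Lemma cvg_normcP T (F : set_system T) (FF : Filter F) (u : T -> R[i]) (l : R[i]) :
  u @ F --> l <-> forall e : R, 0 < e -> \forall t \near F, normc (u t - l) < e.
Proof.
split=> [ul e e0|ul].
  by apply: (ul (fun z => normc (z - l) < e)); apply/nbhs_normcP; exists e.
move=> P /nbhs_normcP[e e0 eP]; have := ul e e0.
by apply: filterS => t; exact: eP.
Qed.

(** The difference quotient is multiplied out by [h]. All later derivatives are estimated in this
    form, which includes [h = 0] and needs no division. *)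
Lemma is_derive_normcP f a d : is_derive a 1 f d <->
  forall e : R, 0 < e -> exists2 r : R, 0 < r &
    forall h, normc h < r -> normc (f (a + h) - f a - d * h) <= e * normc h.
Proof.
have key (h : R[i]) : h != 0 ->
    normc (h^-1 *: ((f \o shift a) (h *: 1) - f a) - d) =
    normc (f (a + h) - f a - d * h) / normc h.
  move=> h0; rewrite -normcV -normcM; congr normc => /=.
  rewrite [h *: 1]mulr1 [h + a]addrC mulrBl (mulrC (_ - _)).
  by rewrite mulfK// .
split=> [[df fd] e e0|dP].
  have : (fun h => h^-1 *: ((f \o shift a) (h *: 1) - f a)) @ 0^' --> d.
    by rewrite -fd.
  move=> /cvg_normcP /(_ e e0) /dnbhs_normcP[r r0 rP]; exists r => // h hr.
  have [->|h0] := eqVneq h 0.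
    by rewrite addr0 subrr mulr0 subr0 normc0 mulr0.
  have := rP h h0; rewrite subr0 => /(_ hr); rewrite key// ltr_pdivrMr ?normc_gt0//.
  exact: ltW.
have dl : (fun h => h^-1 *: ((f \o shift a) (h *: 1) - f a)) @ 0^' --> d.
  apply/cvg_normcP => e e0; apply/dnbhs_normcP.
  have [r r0 rP] := dP (e / 2) (divr_gt0 e0 (ltr0Sn _ _)).
  exists r => // h h0; rewrite subr0 => hr; rewrite key//.
  rewrite ltr_pdivrMr ?normc_gt0//; apply: (le_lt_trans (rP h hr)).
  by rewrite ltr_pM2r ?normc_gt0// ltr_pdivrMr// ltr_pMr// ltr1n.
split; first by apply/cvg_ex; exists d.
exact/cvg_lim.
Qed.

(** The real counterpart, for the real and imaginary parts of a function along a segment. *)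
Lemma is_derive_realP (u : R -> R) (a d : R) :
  (forall e : R, 0 < e -> exists2 r : R, 0 < r &
    forall h, `|h| < r -> `|u (a + h) - u a - d * h| <= e * `|h|) ->
  is_derive a 1 u d.
Proof.
move=> dP.
have dl : (fun h => h^-1 *: ((u \o shift a) (h *: 1) - u a)) @ 0^' --> d.
  apply/cvgrPdistC_lt => e e0.
  have [r r0 rP] := dP (e / 2) (divr_gt0 e0 (ltr0Sn _ _)).
  near=> h.
  have h0 : h != 0 by near: h; exact: nbhs_dnbhs_neq.
  have hr : `|h| < r by near: h; exact: dnbhs0_lt.
  have -> : h^-1 *: ((u \o shift a) (h *: 1) - u a) - d =
    (u (a + h) - u a - d * h) / h.
    by rewrite /= [h *: 1]mulr1 [h + a]addrC [(_ - d * h) / h]mulrBl mulfK// mulrC.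
  rewrite normrM normfV ltr_pdivrMr ?normr_gt0//; apply: (le_lt_trans (rP h hr)).
  by rewrite ltr_pM2r ?normr_gt0// ltr_pdivrMr// ltr_pMr// ltr1n.
split; first by apply/cvg_ex; exists d.
exact/cvg_lim.
Unshelve. all: by end_near. Qed.

Lemma normc_segment r z w (t : R) : 0 <= t <= 1 ->
  normc z <= r -> normc w <= r -> normc (z + t%:C * (w - z)) <= r.
Proof.
move=> /andP[t0 t1] zr wr.
have -> : z + t%:C * (w - z) = (1 - t)%:C * z + t%:C * w.
  by rewrite rmorphB rmorph1; ring.
apply: (le_trans (ler_normcD _ _)); rewrite !normcM !normc_real.
rewrite !ger0_norm ?subr_ge0//; have := normc_ge0 z; have := normc_ge0 w; nra.
Qed.

(** The mean value theorem has no complex version, so the real one is applied to the real and to the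
    imaginary part of [f] along the segment from [z] to [w]. Adding the two bounds gives the factor
    2. *)
Lemma derive_bound_lipschitz f (f' : R[i] -> R[i]) (r e : R) z w :
  (forall s : R[i], is_derive s 1 f (f' s)) ->
  (forall s, normc s <= r -> normc (f' s) <= e) ->
  normc z <= r -> normc w <= r -> normc (f w - f z) <= 2 * e * normc (w - z).
Proof.
move=> df fe zr wr.
(* [p] is the real or the imaginary part. *)
have aux (p : R[i] -> R) : {morph p : x y / x - y} ->
    (forall (x : R[i]) (t : R), p (x * t%:C) = p x * t) ->
    (forall x, `|p x| <= normc x) ->
    `|p (f w - f z)| <= e * normc (w - z).
  move=> pB pZ pn.
  pose u t := p (f (z + t%:C * (w - z))).
  have du (t : R) : is_derive t 1 u (p (f' (z + t%:C * (w - z)) * (w - z))).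
    apply: is_derive_realP => d d0.
    (* The added 1 keeps the divisor positive when [w = z]. *)
    have [|k k0 kP] := iffLR (is_derive_normcP f (z + t%:C * (w - z)) _) (df _)
      (d / (normc (w - z) + 1)).
      by rewrite divr_gt0// ltr_wpDl// normc_ge0.
    have n1 : 0 < normc (w - z) + 1 by rewrite ltr_wpDl// normc_ge0.
    exists (k / (normc (w - z) + 1)); first by rewrite divr_gt0.
    move=> h; rewrite ltr_pdivlMr// => hk.
    have nh : normc (h%:C * (w - z)) <= `|h| * (normc (w - z) + 1).
      by rewrite normcM normc_real ler_wpM2l// lerDl.
    have := kP (h%:C * (w - z)) (le_lt_trans nh hk).
    rewrite /u -pZ -!pB.
    have -> : z + (t + h)%:C * (w - z) = z + t%:C * (w - z) + h%:C * (w - z).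
      by rewrite rmorphD; ring.
    set X := (X in normc X <= _) => XP.
    set Y := (Y in `|p Y|); have -> : Y = X by rewrite /X /Y; ring.
    apply: (le_trans (pn _)); apply: (le_trans XP).
    apply: (le_trans (ler_wpM2l _ nh)); first by rewrite divr_ge0 ?ltW.
    by rewrite mulrCA -!mulrA mulVf ?gt_eqF// mulr1 mulrC.
  have [|c] := @MVT_segment R u (fun t => p (f' (z + t%:C * (w - z)) * (w - z)))
    0 1 ler01 (fun x _ => du x).
    apply: continuous_subspaceT => x.
    apply/differentiable_continuous/derivable1_diffP.
    by have [] := du x.
  rewrite in_itv /= subr0 mulr1 => c01.
  rewrite /u rmorph1 rmorph0 mul1r mul0r addr0 (addrC z) subrK -pB => ->.
  apply: (le_trans (pn _)); rewrite normcM ler_wpM2r ?normc_ge0//.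
  exact/fe/normc_segment.
apply: (le_trans (normc_ReIm _)).
rewrite mulrDl mul1r mulrDl lerD//; apply: aux.
- by move=> [a b] [c d].
- by move=> [a b] t /=; ring.
- exact: normc_Re.
- by move=> [a b] [c d].
- by move=> [a b] t /=; ring.
- exact: normc_Im.
Qed.

End Modulus.

(** * Rules of complex differentiation *)

Section ComplexDerivative.
Context {R : realType}.
Implicit Types (a z w d : R[i]) (f g : R[i] -> R[i]).

Lemma cderiv_cst z d : is_derive z 1 (fun=> d) 0.
Proof. exact: is_derive_cst. Qed.

Lemma cderiv_id z : is_derive z 1 (fun w => w) 1.
Proof. exact: is_derive_id. Qed.

Lemma cderivD z f g a b : is_derive z 1 f a -> is_derive z 1 g b ->
  is_derive z 1 (fun w => f w + g w) (a + b).
Proof. exact: is_deriveD. Qed.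

Lemma cderivM z f g a b : is_derive z 1 f a -> is_derive z 1 g b ->
  is_derive z 1 (fun w => f w * g w) (a * g z + f z * b).
Proof.
move=> df dg; rewrite addrC [a * _]mulrC.
have := @is_deriveM R[i] R[i] f g z 1 a b df dg.
move=> h; exact: h.
Qed.

Lemma cderiv_comp z f g a b : is_derive (g z) 1 f a -> is_derive z 1 g b ->
  is_derive z 1 (fun w => f (g w)) (a * b).
Proof.
move=> df dg; apply/is_derive_normcP => e e0.
have a1 : 0 < normc a + 1 by rewrite ltr_wpDl// normc_ge0.
have b1 : 0 < normc b + 1 by rewrite ltr_wpDl// normc_ge0.
have [|k k0 kP] := iffLR (is_derive_normcP _ _ _) df (e / (2 * (normc b + 1))).
  by rewrite divr_gt0// mulr_gt0.
(* The minimum with 1 bounds the increment [t] of [g] by [normc h * (normc b + 1)]; the other entry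
   makes the error of [g] small after multiplication by [a]. *)
have [|l l0 lP] := iffLR (is_derive_normcP _ _ _) dg
    (Num.min 1 (e / (2 * (normc a + 1)))).
  by rewrite lt_min ltr01 divr_gt0// mulr_gt0.
exists (Num.min l (k / (normc b + 1))); first by rewrite lt_min l0 divr_gt0.
move=> h; rewrite lt_min => /andP[hl]; rewrite ltr_pdivlMr// => hk.
have := lP h hl; set t := g (z + h) - g z.
have gE : g (z + h) = g z + t by rewrite /t; ring.
move=> tP; have nh := normc_ge0 h.
have tb : normc t <= normc h * (normc b + 1).
  have -> : t = (t - b * h) + b * h by ring.
  apply: (le_trans (ler_normcD _ _)); rewrite normcM mulrDr mulr1 addrC mulrC.
  by rewrite lerD2l; apply: (le_trans tP); rewrite ler_piMl// ge_min lexx.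
have := kP t (le_lt_trans tb hk); rewrite -gE.
(* The error of [f] at the increment [t], plus [a] times the error of [g]; each receives half of
   [e]. *)
have -> : f (g (z + h)) - f (g z) - a * b * h =
  (f (g (z + h)) - f (g z) - a * t) + a * (t - b * h) by ring.
move=> fP; apply: (le_trans (ler_normcD _ _)).
have -> : e * normc h = e / 2 * normc h + e / 2 * normc h by field.
apply: lerD.
  apply: (le_trans fP); rewrite -subr_ge0.
  have -> : e / 2 * normc h - e / (2 * (normc b + 1)) * normc t =
    e / (2 * (normc b + 1)) * (normc h * (normc b + 1) - normc t).
    by field; rewrite gt_eqF.
  by rewrite mulr_ge0 ?subr_ge0// divr_ge0 ?mulr_ge0 ?ltW.
rewrite normcM; apply: (@le_trans _ _ ((normc a + 1) * (e / (2 * (normc a + 1)) * normc h))).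
  apply: ler_pM; rewrite ?normc_ge0// ?lerDl//.
  by apply: (le_trans tP); rewrite ler_wpM2r// ge_min lexx orbT.
by rewrite le_eqVlt; apply/orP; left; apply/eqP; field; rewrite gt_eqF.
Qed.

Lemma cderivX z n : is_derive z 1 (fun w : R[i] => w ^+ n) (n%:R * z ^+ n.-1).
Proof.
elim: n => [|n IH].
  rewrite mul0r; under [X in is_derive _ _ X _]eq_fun do rewrite expr0.
  exact: cderiv_cst.
under [X in is_derive _ _ X _]eq_fun do rewrite exprS.
apply: is_derive_eq (cderivM (cderiv_id z) IH) _.
case: n {IH} => [|n]; first by rewrite /= mulr0n mul0r mulr0 addr0.
by rewrite /= [n.+2%:R]mulrS exprS; ring.
Qed.

End ComplexDerivative.

(** * Sequences converging at the rate of powers of 1/2 *)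

Section GeometricLimits.
Context {R : realType}.

Lemma exprN2S n : (2 : R) ^- n = 2 * 2 ^- n.+1.
Proof. by rewrite exprS invfM mulVKf. Qed.

Lemma exprN2_gt0 n : 0 < (2 : R) ^- n.
Proof. by rewrite invr_gt0 exprn_gt0. Qed.

Lemma exprN2_ge0 n : 0 <= (2 : R) ^- n.
Proof. exact/ltW/exprN2_gt0. Qed.

Lemma exprN2_small (M e : R) : 0 < e -> exists n, M * 2 ^- n <= e.
Proof.
move=> e0; have [M0|M0] := leP M 0.
  exists 0%N; apply: (@le_trans _ _ 0); last exact: ltW.
  by rewrite expr0 invr1 mulr1.
exists (Num.truncn (M / e)).
rewrite ler_pdivrMr ?exprn_gt0// mulrC -ler_pdivrMr//.
apply: le_trans (_ : (Num.truncn (M / e)).+1%:R <= _).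
  by apply/ltW/truncnS_gt.
rewrite -natrX ler_nat; exact: ltn_expl.
Qed.

Lemma exprN2_monotone m n : (n <= m)%N -> (2 : R) ^- m <= 2 ^- n.
Proof.
move=> nm; rewrite lef_pV2 ?posrE ?exprn_gt0//.
by rewrite ler_eXn2l// ltr1n.
Qed.

(** The intervals with centre [u n] and radius [2 * M * 2 ^- n] are nested, because a step of
    [M * 2 ^- n] is exactly the loss in radius. The supremum of their left ends lies in all of
    them. *)
Lemma real_geometric_limit (u : nat -> R) (M : R) :
  (forall n, `|u n.+1 - u n| <= M * 2 ^- n) ->
  exists l, forall n, `|u n - l| <= 2 * M * 2 ^- n.
Proof.
move=> uM.
have M0 : 0 <= M.
  by have := le_trans (normr_ge0 _) (uM 0%N); rewrite expr0 invr1 mulr1.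
pose a n := u n - 2 * M * 2 ^- n; pose b n := u n + 2 * M * 2 ^- n.
have step n : a n <= a n.+1 /\ b n.+1 <= b n.
  have := uM n; rewrite /a /b (exprN2S n) ler_norml => /andP[? ?]; split; lra.
have aP m n : (n <= m)%N -> a n <= a m.
  by apply: (homo_leq lexx le_trans) => k; case: (step k).
have bP m n : (n <= m)%N -> b m <= b n.
  move=> nm; rewrite -lerN2; move: n m nm.
  by apply: (homo_leq (f := fun n => - b n) lexx le_trans) => k; rewrite lerN2; case: (step k).
have ab m n : a m <= b n.
  apply: (le_trans (aP (maxn m n) _ (leq_maxl _ _))).
  apply: (le_trans _ (bP (maxn m n) _ (leq_maxr _ _))).
  rewrite /a /b; have := exprN2_gt0 (maxn m n); nra.
exists (sup (range a)) => n; rewrite distrC ler_distl; apply/andP; split.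
  by apply: ub_le_sup; [exists (b 0%N) => _ [k _ <-]|exists n].
by apply: ge_sup => [|_ [k _ <-]]; [exists (a 0%N), 0%N|exact: ab].
Qed.

Lemma geometric_limit (u : nat -> R[i]) (M : R) :
  (forall n, normc (u n.+1 - u n) <= M * 2 ^- n) ->
  exists l, forall n, normc (u n - l) <= 4 * M * 2 ^- n.
Proof.
move=> uM.
have ReB n : `|complex.Re (u n.+1) - complex.Re (u n)| <= normc (u n.+1 - u n).
  by have := normc_Re (u n.+1 - u n); case: (u n.+1) (u n) => ? ? [].
have ImB n : `|complex.Im (u n.+1) - complex.Im (u n)| <= normc (u n.+1 - u n).
  by have := normc_Im (u n.+1 - u n); case: (u n.+1) (u n) => ? ? [].
have [x xP] := @real_geometric_limit (fun n => complex.Re (u n)) M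
  (fun n => le_trans (ReB n) (uM n)).
have [y yP] := @real_geometric_limit (fun n => complex.Im (u n)) M
  (fun n => le_trans (ImB n) (uM n)).
exists (x +i* y) => n; apply: (le_trans (normc_ReIm _)).
have := xP n; have := yP n; case: (u n) => a b /=; lra.
Qed.

(** The geometric error drops below every [e > 0], so an estimate along a sequence passes to its
    limit. *)
Lemma exprN2_limit_le (x y M : R) (N : nat) :
  (forall n, (N <= n)%N -> x <= y + M * 2 ^- n) -> x <= y.
Proof.
move=> xy; apply/ler_addgt0Pr => e e0; have [n nP] := exprN2_small M e0.
have [M0|M0] := leP M 0.
  apply: (le_trans (xy N _)) => //; rewrite lerD2l.
  by apply: (le_trans _ (ltW e0)); rewrite mulr_le0_ge0// exprN2_ge0.
apply: (le_trans (xy (maxn N n) (leq_maxl _ _))); rewrite lerD2l.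
apply: le_trans nP; rewrite ler_pM2l//; apply: exprN2_monotone.
exact: leq_maxr.
Qed.

(** The constant may depend on the disc but not on the point. Letting [F] vary with [n] covers both
    the gap between consecutive terms and the convergence to a fixed limit. *)
Definition geometrically_close (f : nat -> R[i] -> R[i]) (F : nat -> R[i] -> R[i]) :=
  forall r : R, exists M : R, forall n z, normc z <= r ->
    normc (f n z - F n z) <= M * 2 ^- n.

Lemma geometric_limit_fun (f : nat -> R[i] -> R[i]) :
  geometrically_close (fun n => f n.+1) f ->
  exists F, geometrically_close f (fun=> F).
Proof.
move=> fc.
(* The limit at [z] is chosen to satisfy the estimate for every admissible [M], so that the constant
   of a whole disc can be inserted afterwards. *)
have /choice[F FP] z : exists l, forall M : R,
    (forall n, normc (f n.+1 z - f n z) <= M * 2 ^- n) ->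
    forall n, normc (f n z - l) <= 4 * M * 2 ^- n.
  have [M MP] := fc (normc z).
  have [l lP] := geometric_limit (fun n => MP n z (lexx _)).
  exists l => M' M'P; have [l' l'P] := geometric_limit M'P.
  suff -> : l = l' by [].
  apply/eqP; rewrite -subr_eq0 -normc_eq0 eq_le normc_ge0 andbT.
  apply: (@exprN2_limit_le _ _ (4 * M + 4 * M') 0) => n _.
  have -> : l - l' = (f n z - l') - (f n z - l) by ring.
  apply: (le_trans (ler_normcB _ _)); have := lP n; have := l'P n; lra.
exists F => r; have [M MP] := fc r; exists (4 * M) => n z zr.
by apply: FP => k; exact: MP.
Qed.

(** The error of [F] splits into the increment of [F - f n], the error of [f n], and the distance
    from [g n z] to [G z] times [h]. The index [n] is fixed before the radius for [h]. *)
Lemma derive_geometric_limit (f g : nat -> R[i] -> R[i]) (F G : R[i] -> R[i]) :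
  (forall n (z : R[i]), is_derive z 1 (f n) (g n z)) ->
  geometrically_close f (fun=> F) -> geometrically_close g (fun=> G) ->
  forall z : R[i], is_derive z 1 F (G z).
Proof.
move=> df fF gG z; apply/is_derive_normcP => e e0.
have [Mf MfP] := fF (normc z + 1); have [M MP] := gG (normc z + 1).
(* Of the constant 5, 4 pays for the increment of [F - f n] and 1 for the distance from [g n z] to
   [G z]. *)
have [n nP] := @exprN2_small (5 * M) (e / 2) (divr_gt0 e0 (ltr0Sn _ _)).
have [|k k0 kP] := iffLR (is_derive_normcP _ z _) (df n z) (e / 2).
  by rewrite divr_gt0.
exists (Num.min k 1); first by rewrite lt_min k0 ltr01.
move=> h; rewrite lt_min => /andP[hk h1].
have M0 : 0 <= M.
  have := le_trans (normc_ge0 _) (MP 0%N z _); rewrite expr0 invr1 mulr1; apply.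
  by rewrite lerDl.
have zr : normc z <= normc z + 1 by rewrite lerDl.
have zhr : normc (z + h) <= normc z + 1.
  by apply: (le_trans (ler_normcD _ _)); rewrite lerD2l ltW.
(* For [m >= n] the derivative of [f m - f n] is at most [2 * M * 2 ^- n] on the disc, so the mean
   value inequality applies; then [m] tends to infinity. *)
have FfP : normc ((F (z + h) - f n (z + h)) - (F z - f n z)) <=
    4 * M * 2 ^- n * normc h.
  apply: (@exprN2_limit_le _ _ (2 * Mf) n) => m nm.
  have dm (s : R[i]) : is_derive s 1 (f m \- f n) (g m s - g n s).
    by have := df m s; have := df n s => *; exact: is_deriveB.
  have gm (s : R[i]) : normc s <= normc z + 1 ->
      normc (g m s - g n s) <= 2 * M * 2 ^- n.
    move=> sr; have -> : g m s - g n s = (g m s - G s) - (g n s - G s) by ring.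
    apply: (le_trans (ler_normcB _ _)).
    have := MP m s sr; have := MP n s sr.
    have := ler_wpM2l M0 (exprN2_monotone nm); lra.
  have := derive_bound_lipschitz dm gm zr zhr.
  have -> : z + h - z = h by ring.
  rewrite /=.
  have := MfP m z zr; have := MfP m _ zhr.
  set X := normc (f m (z + h) - _); set Y := normc (f m z - _).
  set Z := normc (_ - _ - (f m z - _)) => XP YP ZP.
  have -> : F (z + h) - f n (z + h) - (F z - f n z) =
    (f m (z + h) - f n (z + h) - (f m z - f n z)) +
    ((f m z - F z) - (f m (z + h) - F (z + h))) by ring.
  apply: (le_trans (ler_normcD _ _)).
  have := ler_normcB (f m z - F z) (f m (z + h) - F (z + h)).
  rewrite -/X -/Y -/Z; lra.
have -> : F (z + h) - F z - G z * h =
  (F (z + h) - f n (z + h) - (F z - f n z)) +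
  ((f n (z + h) - f n z - g n z * h) + (g n z - G z) * h) by ring.
apply: (le_trans (ler_normcD _ _)).
have := ler_normcD (f n (z + h) - f n z - g n z * h) ((g n z - G z) * h).
rewrite normcM; have := kP h hk.
have := ler_wpM2r (normc_ge0 h) (MP n z zr).
have := ler_wpM2r (normc_ge0 h) nP.
lra.
Qed.

End GeometricLimits.

(** * The complex exponential series *)

Section ComplexExponential.
Context {R : realType}.
Implicit Types (z w : R[i]).

Definition exp_term z k : R[i] := (k`!%:R)^-1 * z ^+ k.

Definition cexp z : R[i] := limn (series (exp_term z)).

(** Multiplied by [2 ^+ n], the left side is one term of the series of [expR (2 * x)], whose terms
    are all nonnegative. *)
Lemma exp_term_real_bound (x : R) n : 0 <= x ->
  (n`!%:R)^-1 * x ^+ n <= expR (2 * x) * 2 ^- n.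
Proof.
move=> x0.
have x20 : 0 <= 2 * x by rewrite mulr_ge0.
have nd : nondecreasing_seq (series (exp_coeff (2 * x))).
  by apply: nondecreasing_series => k _ _; exact: exp_coeff_ge0.
have := nondecreasing_cvgn_le nd (is_cvg_series_exp_coeff (2 * x)) n.+1.
rewrite -/(expR _) seriesSr => h.
rewrite ler_pdivlMr ?exprn_gt0// -mulrA -exprMn mulrC [x * 2]mulrC.
apply: le_trans h; rewrite lerDr; apply: sumr_ge0 => k _; exact: exp_coeff_ge0.
Qed.

Lemma normc_exp_term z n : normc (exp_term z n) = (n`!%:R)^-1 * normc z ^+ n.
Proof. by rewrite normcM normcX normcV normc_nat. Qed.

Lemma exp_series_geometric :
  geometrically_close (fun n z => series (exp_term z) n.+1)
                      (fun n z => series (exp_term z) n).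
Proof.
move=> r; exists (expR (2 * r)) => n z zr.
rewrite seriesSr addrAC subrr add0r normc_exp_term.
have r0 : 0 <= r := le_trans (normc_ge0 z) zr.
apply: le_trans (exp_term_real_bound n r0).
by rewrite ler_wpM2l// ?invr_ge0// lerXn2r ?nnegrE ?normc_ge0.
Qed.

Lemma cvg_geometric (u : nat -> R[i]) l (M : R) :
  (forall n, normc (u n - l) <= M * 2 ^- n) -> u @ \oo --> l.
Proof.
move=> ul; apply/cvg_normcP => e e0.
have [N NP] := @exprN2_small R M (e / 2) (divr_gt0 e0 (ltr0Sn _ _)).
exists N => // n /= Nn; apply: (le_lt_trans (ul n)).
have M0 : 0 <= M.
  by have := le_trans (normc_ge0 _) (ul 0%N); rewrite expr0 invr1 mulr1.
have := ler_wpM2l M0 (exprN2_monotone Nn : 2 ^- n <= _); lra.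
Qed.

Lemma exp_series_limit :
  geometrically_close (fun n z => series (exp_term z) n) (fun=> cexp).
Proof.
have [F FP] := geometric_limit_fun exp_series_geometric.
suff -> : cexp = F by [].
apply/funext => z; have [M MP] := FP (normc z).
apply: cvg_lim => //; apply: (@cvg_geometric _ _ M) => n; exact: MP.
Qed.

Lemma cvg_cexp z : series (exp_term z) @ \oo --> cexp z.
Proof.
have [M MP] := exp_series_limit (normc z).
by apply: (@cvg_geometric _ _ M) => n; exact: MP.
Qed.

Lemma is_derive_exp_series n z :
  is_derive z 1 (fun w => series (exp_term w) n) (series (exp_term z) n.-1).
Proof.
elim: n => [|n IH].
  rewrite [X in is_derive _ _ X _](_ : _ = cst 0); last first.
    by apply/funext => w; rewrite /series /= big_geq.
  rewrite /series /= big_geq//; exact: is_derive_cst.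
have -> : (fun w => series (exp_term w) n.+1) =
    (fun w => series (exp_term w) n + (n`!%:R)^-1 * w ^+ n).
  by apply/funext => w; rewrite seriesSr.
have dT := cderivM (cderiv_cst z (n`!%:R)^-1) (cderivX z n).
apply: (is_derive_eq (cderivD IH dT)).
case: n {IH dT} => [|n]; first by rewrite /= mulr0n !mul0r mulr0 !addr0.
rewrite /= seriesSr mul0r add0r; congr (_ + _); rewrite /exp_term mulrA.
by congr (_ * _); rewrite factS natrM invfM mulrAC mulVf ?mul1r// pnatr_eq0.
Qed.

Lemma is_derive_cexp z : is_derive z 1 cexp (cexp z).
Proof.
apply: (derive_geometric_limit is_derive_exp_series exp_series_limit).
(* The derivative of a partial sum is the preceding partial sum; this shift by one index doubles the
   constant. *)
move=> r; have [M MP] := exp_series_limit r; exists (2 * M) => -[|n] w wr /=.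
  have := MP 0%N w wr; have := le_trans (normc_ge0 _) (MP 0%N w wr).
  by rewrite expr0 invr1; lra.
by apply: (le_trans (MP n w wr)); rewrite (exprN2S n) mulrCA mulrA lexx.
Qed.

Lemma normc_cexp z : normc (cexp z) <= expR (normc z).
Proof.
have [M MP] := exp_series_limit (normc z).
apply: (@exprN2_limit_le _ _ _ M 0) => n _.
have -> : cexp z = series (exp_term z) n - (series (exp_term z) n - cexp z).
  by ring.
apply: (le_trans (ler_normcB _ _)); apply: lerD; last exact: MP.
have nd : nondecreasing_seq (series (exp_coeff (normc z))).
  by apply: nondecreasing_series => k _ _; exact/exp_coeff_ge0/normc_ge0.
apply: le_trans (nondecreasing_cvgn_le nd (is_cvg_series_exp_coeff _) n).
rewrite /series /=; elim: n => [|n IH]; first by rewrite !big_geq// normc0.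
rewrite !big_nat_recr//=; apply: (le_trans (ler_normcD _ _)).
by rewrite lerD// normc_exp_term /exp_coeff /= mulrC.
Qed.

Lemma cexp0 : cexp 0 = 1.
Proof.
apply: cvg_lim => //; apply: cvg_near_cst; exists 1%N => // -[|n] //= _.
rewrite /series /= big_nat_recl// big1 ?addr0.
  by rewrite /exp_term expr0 fact0 invr1 mulr1.
by move=> k _; rewrite /exp_term expr0n mulr0.
Qed.

End ComplexExponential.

(** * Matrix limits by entries; the exponential of a scalar matrix *)

Section ScalarMatrixExponential.
Context {R : realType} {n : nat}.

Lemma cvg_mx_entry T (F : set_system T) {FF : Filter F} (u : T -> 'M[R[i]]_n)
    (L : 'M[R[i]]_n) i j :
  u @ F --> L -> (fun t => u t i j) @ F --> L i j.
Proof.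
move=> uL A LA.
have := uL [set N | A (N i j)]; apply.
(* A box of neighbourhoods that constrains the entry at [(i, j)] only. *)
exists (fun i' j' => [set x | (i', j') = (i, j) -> A x]) => [i' j'|N NA].
  have [[-> ->]|h] := pselect ((i', j') = (i, j)).
    by apply: filterS LA => x Ax _.
  by apply: (@filterS _ _ _ setT) => [x _ /h|]; last exact: filterT.
exact: NA.
Qed.

Lemma cvg_scalar_mx T (F : set_system T) {FF : Filter F} (u : T -> R[i])
    (l : R[i]) :
  u @ F --> l -> (fun t => (u t)%:M : 'M[R[i]]_n) @ F --> (l%:M : 'M[R[i]]_n).
Proof.
move=> ul A [P lP PA].
(* There are finitely many entries; those off the diagonal are constantly 0. *)
have : \forall t \near F, forall ij, P ij.1 ij.2 ((u t)%:M ij.1 ij.2).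
  apply: filter_forall => -[i j] /=.
  have := lP i j; rewrite !mxE; case: (i =P j) => [-> Pl|/eqP/negbTE ij P0].
    have Fj : \forall t \near F, P j j (u t) by exact: ul Pl.
    by apply: filterS Fj => t; rewrite mxE eqxx.
  have {}P0 : P i j 0 by exact: (nbhs_singleton P0).
  by apply: nearW => t; rewrite mxE ij.
by apply: filterS => t Pt; apply: PA => i j; exact: (Pt (i, j)).
Qed.

(** Uniqueness of the limit is reduced to the entries. *)
Lemma lim_mx (u : nat -> 'M[R[i]]_n) (L : 'M[R[i]]_n) :
  u @ \oo --> L -> limn u = L.
Proof.
move=> uL; have uL' : u @ \oo --> limn u by exact: cvgP uL.
apply/matrixP => i j.
have h : (fun k => u k i j) @ \oo --> L i j by exact: cvg_mx_entry uL.
have h' : (fun k => u k i j) @ \oo --> limn u i j by exact: cvg_mx_entry uL'.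
by rewrite -(cvg_lim _ h)// -(cvg_lim _ h').
Qed.

Lemma expmx_scalar (c : R[i]) : expmx (c%:M : 'M[R[i]]_n) = (cexp c)%:M.
Proof.
apply: lim_mx.
have : (fun k => (series (exp_term c) k)%:M) @ \oo --> ((cexp c)%:M : 'M[R[i]]_n).
  by apply: cvg_scalar_mx; exact: cvg_cexp.
apply: cvg_trans.
apply: near_eq_cvg; apply: nearW => k; rewrite /series /=.
elim: k => [|k IH]; first by rewrite !big_geq// raddf0.
rewrite !big_nat_recr//= raddfD/= IH; congr (_ + _).
have -> : (c%:M : 'M[R[i]]_n) ^+ k = (c ^+ k)%:M.
  elim: k {IH} => [|k IH]; rewrite ?expr0// !exprS IH.
  by rewrite scalar_mxM.
by rewrite scale_scalar_mx.
Qed.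

End ScalarMatrixExponential.

(** * Infinite products of differentiable functions *)

Section InfiniteProducts.
Context {R : realType}.
Implicit Types (f g : nat -> R[i] -> R[i]).

Lemma geometrically_close_eventually f g :
  (forall r n, exists C : R, forall z, normc z <= r ->
    normc (f n z - g n z) <= C) ->
  (forall r, exists N, exists C : R, forall n z, (N <= n)%N -> normc z <= r ->
    normc (f n z - g n z) <= C * 2 ^- n) ->
  geometrically_close f g.
Proof.
move=> fgn fgN r; have [N] := fgN r; elim: N => [|N IH] [C CP].
  by exists C => n z; exact: CP.
have [C' C'P] := fgn r N.
(* The threshold goes down by one: the factor [2 ^+ N] turns the plain bound at index [N] into one
   of geometric form. *)
apply: IH; exists (Num.max C (C' * 2 ^+ N)) => n z; rewrite leq_eqVlt.
case/orP => [/eqP <- zr|Nn zr].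
  apply: (le_trans (C'P z zr)); rewrite ler_pdivlMr ?exprn_gt0//.
  by rewrite le_max lexx orbT.
apply: (le_trans (CP n z Nn zr)); rewrite ler_wpM2r ?exprN2_ge0//.
by rewrite le_max lexx.
Qed.

Lemma geometrically_close_shift f g N : geometrically_close f g ->
  geometrically_close (fun n => f (N + n)%N) (fun n => g (N + n)%N).
Proof.
move=> fg r; have [M MP] := fg r; exists (M * 2 ^- N) => n z zr.
apply: (le_trans (MP _ z zr)).
by rewrite exprD invfM mulrA lexx.
Qed.

(** The product rule unrolled. In contrast to a logarithmic derivative, nothing is divided by
    factors that may vanish. *)
Fixpoint prod_derivative f g n z : R[i] :=
  if n is k.+1 then
    prod_derivative f g k z * f k z + (\prod_(0 <= j < k) f j z) * g k z
  else 0.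

Lemma is_derive_prod f g : (forall n (z : R[i]), is_derive z 1 (f n) (g n z)) ->
  forall n (z : R[i]),
    is_derive z 1 (fun w => \prod_(0 <= j < n) f j w) (prod_derivative f g n z).
Proof.
move=> df; elim=> [|n IH] z.
  have -> : (fun w => \prod_(0 <= j < 0) f j w) = (fun=> 1).
    by apply/funext => w; rewrite big_geq.
  exact: cderiv_cst.
have -> : (fun w => \prod_(0 <= j < n.+1) f j w) =
    (fun w => (\prod_(0 <= j < n) f j w) * f n w).
  by apply/funext => w; rewrite big_nat_recr.
exact: cderivM.
Qed.

(* The sum of the moduli of the partial product and of its derivative grows at
   each step by a factor at most [1 + 2 C / 2 ^ n], hence stays bounded. *)
Lemma prod_and_derivative_bounded f g (C r : R) :
  (forall n z, normc z <= r -> normc (f n z - 1) <= C * 2 ^- n) ->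
  (forall n z, normc z <= r -> normc (g n z) <= C * 2 ^- n) ->
  forall n z, normc z <= r ->
    normc (\prod_(0 <= j < n) f j z) + normc (prod_derivative f g n z) <=
      expR (4 * C).
Proof.
move=> fC gC n z zr.
have C0 : 0 <= C.
  by have := le_trans (normc_ge0 _) (fC 0%N z zr); rewrite expr0 invr1 mulr1.
have fle k : normc (f k z) <= 1 + C * 2 ^- k.
  have -> : f k z = 1 + (f k z - 1) by ring.
  by apply: (le_trans (ler_normcD _ _)); rewrite normc1 lerD2l fC.
(* The exponent is the sum of [2 * C * 2 ^- k] over [k < n], which matches the growth factors
   through [1 + x <= expR x]. *)
suff : normc (\prod_(0 <= j < n) f j z) + normc (prod_derivative f g n z) <=
    expR (4 * C - 4 * C * 2 ^- n).
  move=> /le_trans; apply; rewrite ler_expR gerBl.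
  by rewrite !mulr_ge0// exprN2_ge0.
elim: n => [|n IH].
  by rewrite big_geq// normc1 normc0 expr0 invr1 mulr1 subrr expR0 addr0.
have -> : 4 * C - 4 * C * 2 ^- n.+1 =
    2 * C * 2 ^- n + (4 * C - 4 * C * 2 ^- n).
  by rewrite (exprN2S n); ring.
rewrite expRD big_nat_recr//=; set P := \prod_(_ <= _ < _) _ in IH *.
set D := prod_derivative f g n z in IH *.
apply: (@le_trans _ _ ((1 + 2 * C * 2 ^- n) * (normc P + normc D))).
  have := ler_normcD (D * f n z) (P * g n z); rewrite !normcM.
  have := ler_wpM2l (normc_ge0 P) (gC n z zr).
  have := ler_wpM2l (normc_ge0 P) (fle n).
  have := ler_wpM2l (normc_ge0 D) (fle n).
  have := mulr_ge0 (mulr_ge0 C0 (exprN2_ge0 (R := R) n)) (normc_ge0 D).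
  lra.
apply: ler_pM => //.
- by rewrite addr_ge0// !mulr_ge0// exprN2_ge0.
- by rewrite addr_ge0// normc_ge0.
- exact: expR_ge1Dx.
Qed.

Lemma common_geometric_bound f g :
  geometrically_close f (fun _ _ => 1) -> geometrically_close g (fun _ _ => 0) ->
  forall r, exists C : R,
    (forall n z, normc z <= r -> normc (f n z - 1) <= C * 2 ^- n) /\
    (forall n z, normc z <= r -> normc (g n z) <= C * 2 ^- n).
Proof.
move=> f1 g0 r; have [C CP] := f1 r; have [C' C'P] := g0 r.
exists (Num.max C C'); split=> n z zr.
  apply: (le_trans (CP n z zr)).
  by rewrite ler_wpM2r ?exprN2_ge0// le_max lexx.
have := C'P n z zr; rewrite subr0 => h; apply: (le_trans h).
by rewrite ler_wpM2r ?exprN2_ge0// le_max lexx orbT.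
Qed.

(** Consecutive partial products differ by a bounded quantity times [f n z - 1], and their
    derivatives by a similar expression in [f n z - 1] and [g n z]. Both gaps are geometric, so
    limits exist and differentiation passes to the limit. *)
Lemma infinite_product f g :
  (forall n (z : R[i]), is_derive z 1 (f n) (g n z)) ->
  geometrically_close f (fun _ _ => 1) -> geometrically_close g (fun _ _ => 0) ->
  exists p, (forall z : R[i], exists d, is_derive z 1 p d) /\
    geometrically_close (fun n z => \prod_(0 <= j < n) f j z) (fun=> p).
Proof.
move=> df f1 g0.
have bnd := common_geometric_bound f1 g0.
have Pc : geometrically_close (fun n z => \prod_(0 <= j < n.+1) f j z)
    (fun n z => \prod_(0 <= j < n) f j z).
  move=> r; have [C [fC gC]] := bnd r; exists (C * expR (4 * C)) => n z zr.
  rewrite big_nat_recr//=; set P := \prod_(_ <= _ < _) _.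
  have -> : P * f n z - P = P * (f n z - 1) by ring.
  rewrite normcM mulrAC mulrC ler_pM ?normc_ge0 ?fC//.
  apply: le_trans (prod_and_derivative_bounded fC gC n zr).
  by rewrite lerDl normc_ge0.
have Dc : geometrically_close (prod_derivative f g \o S) (prod_derivative f g).
  move=> r; have [C [fC gC]] := bnd r; exists (C * expR (4 * C)) => n z zr /=.
  have := prod_and_derivative_bounded fC gC n zr.
  set P := \prod_(_ <= _ < _) _; set D := prod_derivative f g n z => PD.
  have -> : D * f n z + P * g n z - D = D * (f n z - 1) + P * g n z by ring.
  apply: (le_trans (ler_normcD _ _)); rewrite !normcM.
  have := ler_wpM2l (normc_ge0 D) (fC n z zr).
  have := ler_wpM2l (normc_ge0 P) (gC n z zr).
  have := ler_wpM2l (le_trans (normc_ge0 _) (fC n z zr)) PD.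
  lra.
have [p pP] := geometric_limit_fun Pc; have [d dP] := geometric_limit_fun Dc.
exists p; split=> // z; exists (d z).
exact: (derive_geometric_limit (is_derive_prod df) pP dP).
Qed.

Lemma geometrically_close_unique f (p q : R[i] -> R[i]) :
  geometrically_close f (fun=> p) -> geometrically_close f (fun=> q) -> p = q.
Proof.
move=> fp fq; apply/funext => z; apply/eqP; rewrite -subr_eq0 -normc_eq0.
have [M MP] := fp (normc z); have [M' M'P] := fq (normc z).
rewrite eq_le normc_ge0 andbT.
apply: (@exprN2_limit_le _ _ _ (M + M') 0) => n _; rewrite add0r.
have -> : p z - q z = (f n z - q z) - (f n z - p z) by ring.
apply: (le_trans (ler_normcB _ _)).
by rewrite mulrDl addrC lerD ?MP ?M'P.
Qed.

(** The factors from index [N] on form an infinite product [q] of the same kind; uniqueness of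
    limits identifies [p] with the finite part times [q]. This makes zeros of finitely many factors
    into zeros of [p]. *)
Lemma infinite_product_split f g :
  (forall n (z : R[i]), is_derive z 1 (f n) (g n z)) ->
  geometrically_close f (fun _ _ => 1) -> geometrically_close g (fun _ _ => 0) ->
  exists p, [/\ (forall z : R[i], exists d, is_derive z 1 p d),
    geometrically_close (fun n z => \prod_(0 <= j < n) f j z) (fun=> p) &
    forall N, exists q, (forall z : R[i], exists d, is_derive z 1 q d) /\
      forall z, p z = (\prod_(0 <= j < N) f j z) * q z].
Proof.
move=> df f1 g0; have [p [dp pP]] := infinite_product df f1 g0.
exists p; split=> // N.
have [q [dq qP]] := infinite_product (fun n => df (N + n)%N)
  (geometrically_close_shift N f1) (geometrically_close_shift N g0).
exists q; split=> //.
suff : p = fun z => (\prod_(0 <= j < N) f j z) * q z by move=> ->.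
apply: (geometrically_close_unique (geometrically_close_shift N pP)) => r.
have [M MP] := qP r.
have [C [fC gC]] := common_geometric_bound f1 g0 r.
exists (expR (4 * C) * M) => n z zr.
have -> : \prod_(0 <= j < N + n) f j z =
    (\prod_(0 <= j < N) f j z) * \prod_(0 <= j < n) f (N + j)%N z.
  rewrite (big_cat_nat (n := N)) ?leq_addr//=; congr (_ * _).
  rewrite -[in LHS](add0n N) big_addn add0n addKn.
  by apply: eq_bigr => j _; rewrite addnC.
rewrite -mulrBr normcM -mulrA ler_pM ?normc_ge0 ?MP//.
apply: le_trans (prod_and_derivative_bounded fC gC N zr).
by rewrite lerDl normc_ge0.
Qed.

End InfiniteProducts.

(** * Elementary factors and convergence of the Weierstrass product *)

Section WeierstrassFactors.
Context {R : realType}.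
Implicit Types (u z : R[i]).

(** The Taylor polynomial of degree [k] of - log (1 - u) at 0. *)
Definition log_part k u : R[i] := \sum_(1 <= l < k.+1) l%:R^-1 * u ^+ l.

Definition weierstrass k u : R[i] := cexp (log_part k u) * (1 - u).

Lemma log_part0 k : log_part k 0 = 0.
Proof.
rewrite /log_part big_nat big1// => -[|l]// _; by rewrite expr0n mulr0.
Qed.

Lemma is_derive_log_part k u :
  is_derive u 1 (log_part k) (\sum_(0 <= l < k) u ^+ l).
Proof.
elim: k => [|k IH].
  have -> : log_part 0 = (fun=> 0) by apply/funext => w; rewrite /log_part big_geq.
  by rewrite big_geq//; exact: cderiv_cst.
have -> : log_part k.+1 = (fun w => log_part k w + k.+1%:R^-1 * w ^+ k.+1).
  by apply/funext => w; rewrite /log_part big_nat_recr.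
have dX := cderivM (cderiv_cst u k.+1%:R^-1) (cderivX u k.+1).
apply: (is_derive_eq (cderivD IH dX)).
by rewrite big_nat_recr//= mul0r add0r mulrA mulVf ?mul1r// pnatr_eq0.
Qed.

Lemma is_derive_weierstrass k u :
  is_derive u 1 (weierstrass k) (- u ^+ k * cexp (log_part k u)).
Proof.
have d1 := cderivD (cderiv_cst u 1) (cderivM (cderiv_cst u (-1)) (cderiv_id u)).
have de := cderiv_comp (is_derive_cexp _) (is_derive_log_part k u).
have -> : weierstrass k = fun w => cexp (log_part k w) * (1 + -1 * w).
  by apply/funext => w; rewrite mulN1r.
apply: (is_derive_eq (cderivM de d1)).
(* The product rule leaves the exponential times this product minus 1; the geometric sum telescopes,
   and only [- u ^+ k] survives. *)
have geo : (\sum_(0 <= l < k) u ^+ l) * (1 - u) = 1 - u ^+ k.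
  by rewrite -[1 - u ^+ k]opprB subrX1 big_mkord; ring.
have -> : - u ^+ k = (\sum_(0 <= l < k) u ^+ l) * (1 - u) - 1 by rewrite geo; ring.
ring.
Qed.

(** A majorant of [log_part] with the coefficients 1/l replaced by 1. At 1/2 it stays below 1 for
    all [k], which makes the estimates uniform in the degree. *)
Definition log_bound k (x : R) : R := \sum_(1 <= l < k.+1) x ^+ l.

Lemma log_bound_mono k x y : 0 <= x -> x <= y -> log_bound k x <= log_bound k y.
Proof.
move=> x0 xy; apply: ler_sum => l _.
by rewrite lerXn2r// nnegrE// (le_trans x0).
Qed.

Lemma log_bound_half k : log_bound k 2^-1 <= 1.
Proof.
suff -> : log_bound k 2^-1 = 1 - 2 ^- k by rewrite gerBl exprN2_ge0.
elim: k => [|k IH]; first by rewrite /log_bound big_geq// expr0 invr1 subrr.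
rewrite /log_bound big_nat_recr//= -/(log_bound k _) IH exprVn (exprN2S k); lra.
Qed.

Lemma normc_log_part k u : normc (log_part k u) <= log_bound k (normc u).
Proof.
rewrite /log_part /log_bound; elim: k => [|k IH]; first by rewrite !big_geq// normc0.
rewrite big_nat_recr// [leRHS]big_nat_recr//=.
apply: (le_trans (ler_normcD _ _)); apply: lerD => //.
rewrite normcM normcX normcV normc_nat ler_piMl ?exprn_ge0 ?normc_ge0//.
by rewrite invf_le1 ?ltr0n// ler1n.
Qed.

Lemma normc_weierstrass_derivative k u (x : R) : normc u <= x ->
  normc (- u ^+ k * cexp (log_part k u)) <= x ^+ k * expR (log_bound k x).
Proof.
move=> ux; have x0 := le_trans (normc_ge0 u) ux.
rewrite normcM normc_opp normcX ler_pM ?exprn_ge0 ?normc_ge0//.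
  by rewrite lerXn2r// ?nnegrE ?normc_ge0.
apply: (le_trans (normc_cexp _)); rewrite ler_expR.
by apply: (le_trans (normc_log_part _ _)); exact/log_bound_mono/ux/normc_ge0.
Qed.

(** The mean value inequality between 0, where the factor equals 1, and [u]. *)
Lemma normc_weierstrass_sub1 k u (x : R) : normc u <= x ->
  normc (weierstrass k u - 1) <= 2 * (x ^+ k * expR (log_bound k x)) * x.
Proof.
move=> ux; have x0 := le_trans (normc_ge0 u) ux.
have := @derive_bound_lipschitz _ _ _ x (x ^+ k * expR (log_bound k x)) 0 u
  (is_derive_weierstrass k) (fun s => @normc_weierstrass_derivative k s x).
rewrite normc0 subr0 {2}/weierstrass log_part0 cexp0 subr0 mulr1.
move=> /(_ x0 ux) h; apply: (le_trans h).
by rewrite ler_wpM2l// !mulr_ge0 ?exprn_ge0 ?expR_ge0.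
Qed.

Variable zs : nat -> R[i].
Hypothesis zs_cvg : forall M : R, \forall k \near \oo, M <= normc (zs k).

(** The degree is [k.+1] because indices start at 0. Since it grows with the index, the product
    converges for every sequence tending to infinity. *)
Definition canonical_term k z := weierstrass k.+1 (z / zs k).

Definition canonical_term_derivative k z :=
  - (z / zs k) ^+ k.+1 * cexp (log_part k.+1 (z / zs k)) / zs k.

Lemma is_derive_canonical_term k z :
  is_derive z 1 (canonical_term k) (canonical_term_derivative k z).
Proof.
have d := cderivM (cderiv_id z) (cderiv_cst z (zs k)^-1).
apply: (is_derive_eq (cderiv_comp (is_derive_weierstrass k.+1 _) d)).
by rewrite mul1r mulr0 addr0.
Qed.

Lemma normc_quotient_zs r k z : normc z <= r ->
  normc (z / zs k) <= r / normc (zs k).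
Proof. by move=> zr; rewrite normcM normcV ler_wpM2r ?invr_ge0 ?normc_ge0. Qed.

(** The first bound yields powers of 1/2; the second absorbs the division by [zs n] in the
    derivative of a term. *)
Lemma eventually_half r : exists N, forall n, (N <= n)%N ->
  r / normc (zs n) <= 2^-1 /\ 1 <= normc (zs n).
Proof.
have [N _ NP] := zs_cvg (Num.max 1 (2 * r)).
exists N => n /NP /=; rewrite ge_max => /andP[n1 n2]; split=> //.
by rewrite ler_pdivrMr ?(lt_le_trans ltr01)//; lra.
Qed.

Lemma half_pow_bound k (x : R) : 0 <= x -> x <= 2^-1 ->
  x ^+ k * expR (log_bound k x) <= expR 1 * 2 ^- k.
Proof.
move=> x0 x2; rewrite mulrC ler_pM ?expR_ge0 ?exprn_ge0//.
  by rewrite ler_expR (le_trans _ (log_bound_half k))// log_bound_mono.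
by rewrite -exprVn lerXn2r// nnegrE// invr_ge0.
Qed.

Lemma canonical_term_close : geometrically_close canonical_term (fun _ _ => 1).
Proof.
apply: geometrically_close_eventually => r.
  move=> n; exists (2 * ((r / normc (zs n)) ^+ n.+1 *
    expR (log_bound n.+1 (r / normc (zs n)))) * (r / normc (zs n))) => z zr.
  exact/normc_weierstrass_sub1/normc_quotient_zs.
have [N NP] := eventually_half r; exists N; exists (2 * expR 1) => n z Nn zr.
have [h1 h2] := NP n Nn.
apply: (le_trans (normc_weierstrass_sub1 _ (normc_quotient_zs n zr))).
have x0 : 0 <= r / normc (zs n).
  by rewrite divr_ge0 ?normc_ge0// (le_trans (normc_ge0 z)).
have := half_pow_bound n.+1 x0 h1; set X := _ * expR _ => hX.
have X0 : 0 <= X by rewrite mulr_ge0 ?expR_ge0 ?exprn_ge0.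
have : X * (r / normc (zs n)) <= X * 2^-1 by rewrite ler_wpM2l.
have := exprN2S (R := R) n; have := exprN2_ge0 (R := R) n.+1.
have := expR_ge0 (1 : R); nra.
Qed.

Lemma canonical_term_derivative_close :
  geometrically_close canonical_term_derivative (fun _ _ => 0).
Proof.
have bnd r n z : normc z <= r -> normc (canonical_term_derivative n z - 0) <=
    (r / normc (zs n)) ^+ n.+1 * expR (log_bound n.+1 (r / normc (zs n))) /
      normc (zs n).
  move=> zr; rewrite subr0 normcM normcV ler_wpM2r ?invr_ge0 ?normc_ge0//.
  exact/normc_weierstrass_derivative/normc_quotient_zs.
apply: geometrically_close_eventually => r.
  by move=> n; eexists => z zr; exact: bnd zr.
have [N NP] := eventually_half r; exists N; exists (expR 1) => n z Nn zr.
have [h1 h2] := NP n Nn; apply: (le_trans (bnd _ _ _ zr)).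
have x0 : 0 <= r / normc (zs n).
  by rewrite divr_ge0 ?normc_ge0// (le_trans (normc_ge0 z)).
have := half_pow_bound n.+1 x0 h1; set X := _ * expR _ => hX.
have X0 : 0 <= X by rewrite mulr_ge0 ?expR_ge0 ?exprn_ge0.
rewrite ler_pdivrMr ?(lt_le_trans ltr01)//.
have := exprN2S (R := R) n; have := exprN2_ge0 (R := R) n.+1.
have := expR_ge0 (1 : R) => e0 p0 pS.
apply: (le_trans hX); rewrite -mulrA ler_wpM2l// pS; nra.
Qed.

Lemma weierstrass_product : exists p,
  [/\ (forall z : R[i], exists d, is_derive z 1 p d),
    geometrically_close
      (fun n z => \prod_(0 <= j < n) canonical_term j z) (fun=> p) &
    forall N, exists q, (forall z : R[i], exists d, is_derive z 1 q d) /\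
      forall z, p z = (\prod_(0 <= j < N) canonical_term j z) * q z].
Proof.
exact: (infinite_product_split is_derive_canonical_term
  canonical_term_close canonical_term_derivative_close).
Qed.

End WeierstrassFactors.

(** * Canonical products all of whose projections are the identity *)

Section ScalarCanonicalProducts.
Context {R : realType} {n : nat}.
Implicit Types (zs : nat -> R[i]).

(** Scaling a vector by [c] scales its norm by [normc c]. Equality fails when [n = 0], where the
    operator norm is 0 for every [c]. *)
Lemma op_norm_scalar (c : R[i]) : op_norm (c%:M : 'M[R[i]]_n) <= normc c.
Proof.
apply: ge_sup => [|_ [v /= v1 <-]].
  exists (eucl_norm (c%:M *m (0 : 'cV[R[i]]_n))), 0 => //=.
  rewrite /eucl_norm big1 ?sqrtr0// => i _.
  by rewrite mxE [normc _]normc0 expr0n.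
suff -> : eucl_norm (c%:M *m v) = normc c * eucl_norm v.
  by rewrite ler_piMr// normc_ge0.
rewrite /eucl_norm -[X in X * _](ger0_norm (normc_ge0 c)) -sqrtr_sqr.
rewrite -sqrtrM ?sqr_ge0// mulr_sumr; congr Num.sqrt; apply: eq_bigr => i _.
by rewrite mul_scalar_mx mxE normcM exprMn.
Qed.

Lemma orthogonal_projection1 : orthogonal_projection (1%:M : 'M[R[i]]_n).
Proof.
split; first by rewrite mul1mx.
apply/is_hermitianmxP; rewrite expr0 scale1r.
by rewrite trmx1 map_scalar_mx rmorph1.
Qed.

Lemma canonical_factor_scalar zs k (z : R[i]) :
  canonical_factor k.+1 (zs k) (1%:M : 'M[R[i]]_n) z = (canonical_term zs k z)%:M.
Proof.
rewrite /canonical_factor -scaler_suml !scalemx1 expmx_scalar.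
rewrite -[1%:M]/(1%:M) -raddfB /= -scalar_mxM; congr (_%:M).
rewrite /canonical_term /weierstrass; congr (cexp _ * _).
by apply: eq_bigr => l _; rewrite expr_div_n.
Qed.

Lemma canonical_partial_product_scalar zs k (z : R[i]) :
  canonical_partial_product zs (fun=> 1%:M : 'M[R[i]]_n) k z =
    (\prod_(0 <= j < k) canonical_term zs j z)%:M.
Proof.
elim: k => [|k IH]; first by rewrite big_geq.
(* The new factor stands on the left in the matrix product and on the right in the scalar one. *)
by rewrite /= IH canonical_factor_scalar -scalar_mxM big_nat_recr// mulrC.
Qed.

Lemma cvg_normr_pinfty (zs : nat -> R[i]) :
  (forall M : R, \forall k \near \oo, M <= normc (zs k)) ->
  `|zs k| @[k --> \oo] --> +oo.
Proof.
move=> zsM P [M [Mr MP]].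
(* Neighbourhoods of [+oo] in [R[i]] are given by a real element [M]; adding 1 turns the weak bound
   into a strict one. *)
have [N _ NP] := zsM (complex.Re M + 1).
exists N => // k /NP h /=; apply: MP.
have -> : M = (complex.Re M)%:C by rewrite RRe_real.
by rewrite normr_normc ltcR; apply: lt_le_trans h; rewrite ltrDl.
Qed.

Lemma bounded_set_normc (B : set R[i]) : bounded_set B ->
  exists r : R, forall z, B z -> normc z <= r.
Proof.
move=> [M [Mr MP]]; exists (complex.Re M + 1) => z Bz.
have := MP (complex.Re M + 1)%:C; rewrite -lecR -normr_normc; apply => //.
have {1}-> : M = (complex.Re M)%:C by rewrite RRe_real.
by rewrite ltcR ltrDl.
Qed.

Lemma canonical_product_form_scalar zs (p : R[i] -> R[i]) :
  (forall k, zs k != 0) ->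
  (forall M : R, \forall k \near \oo, M <= normc (zs k)) ->
  (forall z : R[i], exists d, is_derive z 1 p d) ->
  geometrically_close
    (fun k z => \prod_(0 <= j < k) canonical_term zs j z) (fun=> p) ->
  canonical_product_form (fun z => (p z)%:M : 'M[R[i]]_n).
Proof.
move=> zs0 zsM dp pP; split.
  move=> i j a; have [d pd] := dp a.
  have h := cderivM pd (cderiv_cst a (i == j)%:R).
  have -> : (fun z => (p z)%:M i j) = (fun z => p z * (i == j)%:R).
    by apply/funext => z; rewrite mxE mulr_natr.
  by case: h.
exists (fun=> 1%:M), zs; split=> //.
- by move=> _; exact: orthogonal_projection1.
- exact: cvg_normr_pinfty.
move=> B /bounded_set_normc[r rP] e e0; have [M MP] := pP r.
(* The absolute value is taken because [M] may be negative when the disc of radius [r] is empty. *)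
have [N NP] := @exprN2_small R `|M| (e / 2) (divr_gt0 e0 (ltr0Sn _ _)).
exists N => // k /= Nk z Bz.
rewrite canonical_partial_product_scalar -raddfB /=.
apply: (le_lt_trans (op_norm_scalar _)); apply: (le_lt_trans (MP k z (rP z Bz))).
have := ler_wpM2r (exprN2_ge0 (R := R) k) (ler_norm M).
have := ler_wpM2l (normr_ge0 M) (exprN2_monotone Nk : 2 ^- k <= _); lra.
Qed.

End ScalarCanonicalProducts.

(** * Compactness and locally finite sets in the plane *)

Section LocallyFiniteSets.
Context {R : realType}.
Implicit Types (a z : R[i]).

Lemma continuous_complex : continuous (fun xy : R * R => xy.1 +i* xy.2).
Proof.
move=> [x y] A /nbhs_normcP[e e0 eA].
have e2 : 0 < e / 2 by rewrite divr_gt0.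
exists (ball x (e / 2), ball y (e / 2)) => /=; first by split; exact: nbhsx_ballx.
move=> [x' y'] [/= xx' yy']; apply: eA; apply: (le_lt_trans (normc_ReIm _)).
rewrite /= distrC (distrC y') [e]splitr; exact: ltrD.
Qed.

Lemma compact_square (r : R) :
  compact [set z : R[i] | `|complex.Re z| <= r /\ `|complex.Im z| <= r].
Proof.
have -> : [set z : R[i] | `|complex.Re z| <= r /\ `|complex.Im z| <= r] =
    (fun xy : R * R => xy.1 +i* xy.2) @` (`[- r, r] `*` `[- r, r]).
  apply/seteqP; split=> [[x y] /= [xr yr]|_ [[x y] /= [+ +] <-]].
    by exists (x, y) => //=; rewrite !in_itv /= -!ler_norml.
  by rewrite !in_itv /= -!ler_norml.
apply: continuous_compact.
  exact/continuous_subspaceT/continuous_complex.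
by apply: compact_setX; exact: segment_compact.
Qed.

(** The open sets [U a] meet [S] at most in [a]. Finitely many of them cover a square containing the
    disc, and their centres include all points of [S] in it. *)
Lemma locally_finite_disc (S : set R[i]) (r : R) :
  (forall a, \forall z \near a^', ~ S z) ->
  finite_set [set z | S z /\ normc z <= r].
Proof.
move=> SN; pose U a := ([set z | z = a \/ ~ S z])°.
have [D _ DP] : finite_subset_cover setT U
    [set z : R[i] | `|complex.Re z| <= r /\ `|complex.Im z| <= r].
  have := @compact_square r; rewrite compact_cover; apply.
    by move=> a _; exact: open_interior.
  move=> a _; exists a => //; rewrite /U /interior /=.
  have /dnbhs_normcP[e e0 eP] := SN a; apply/nbhs_normcP; exists e => // z ze.
  by have [->|za] := eqVneq z a; [left|right; exact: eP].
apply: sub_finite_set (finite_fset D).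
move=> z [Sz zr]; have [|a aD /interior_subset[->//|//]] := DP z.
by split; apply: le_trans zr; [exact: normc_Re|exact: normc_Im].
Qed.

End LocallyFiniteSets.

(** * Concatenating infinitely many finite lists *)

Section Concatenation.
Variables (T : eqType) (x0 : T) (L : nat -> seq T).
Hypothesis L_nonempty : forall r, L r != [::].

Definition concat_below r := flatten [seq L i | i <- iota 0 r].

(** With nonempty lists, the first [k.+1] of them have an entry at position [k], so the default [x0]
    is never returned. *)
Definition concat_seq k := nth x0 (concat_below k.+1) k.

Lemma concat_below_cat r d :
  concat_below (r + d) = concat_below r ++ flatten [seq L i | i <- iota r d].
Proof. by rewrite /concat_below iotaD map_cat flatten_cat. Qed.

Lemma leq_size_concat r : (r <= size (concat_below r))%N.
Proof.
elim: r => // r IH; rewrite -addn1 concat_below_cat size_cat /= cats0.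
by rewrite leq_add// lt0n size_eq0.
Qed.

Lemma nth_concat_below r k : (k < size (concat_below r))%N ->
  nth x0 (concat_below r) k = concat_seq k.
Proof.
move=> kr; rewrite /concat_seq; have [rk|kr'] := leqP r k.+1.
  by rewrite -(subnKC rk) concat_below_cat nth_cat kr.
by rewrite -(subnKC (ltnW kr')) concat_below_cat nth_cat leq_size_concat.
Qed.

Lemma mkseq_concat_seq r :
  mkseq concat_seq (size (concat_below r)) = concat_below r.
Proof.
apply: (@eq_from_nth _ x0); rewrite size_mkseq// => k kr.
by rewrite nth_mkseq// nth_concat_below.
Qed.

(** Entries beyond the first [r] lists come from later lists; this forces the sequence to infinity
    once the lists do. *)
Lemma concat_seq_in r k : (size (concat_below r) <= k)%N ->
  exists i, (r <= i)%N /\ concat_seq k \in L i.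
Proof.
move=> rk; have rk1 : (r <= k.+1)%N.
  exact: leq_trans (leq_trans (leq_size_concat r) rk) (leqnSn k).
have := leq_size_concat k.+1; rewrite /concat_seq.
rewrite -(subnKC rk1) concat_below_cat size_cat nth_cat ltnNge rk /= => ksz.
set F := flatten _ in ksz *.
have /flattenP[s sL h] : nth x0 F (k - size (concat_below r)) \in F.
  by apply: mem_nth; rewrite ltn_subLR// -[k.+1](subnKC rk1).
have [i + sE] := mapP sL; rewrite mem_iota => /andP[ri _].
rewrite sE in h; by exists i.
Qed.

Lemma count_concat_seq x r :
  exists N, (count_mem x (L r) <= count_mem x (mkseq concat_seq N))%N.
Proof.
exists (size (concat_below r.+1)); rewrite mkseq_concat_seq -addn1.
by rewrite concat_below_cat count_cat /= cats0 leq_addl.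
Qed.

End Concatenation.

(** * Sequences with prescribed multiplicities *)

Section Divisors.
Context {R : realType}.

Lemma leq_count_flatten_nseq (m : R[i] -> nat) (s : seq R[i]) a : a \in s ->
  (m a <= count_mem a (flatten [seq nseq (m b) b | b <- s]))%N.
Proof.
case/splitPr => s1 s2; rewrite map_cat flatten_cat count_cat /= count_cat.
by rewrite count_nseq /= eqxx mul1n addnCA leq_addr.
Qed.

(** The plane is cut into the annuli of radii [r] and [r.+1]. Each contains finitely many points
    with [m a != 0]; these are listed with multiplicity, annulus after annulus. *)
Lemma divisor_sequence (m : R[i] -> nat) : m 0 = 0%N ->
  (forall a : R[i], \forall z \near a^', m z = 0%N) ->
  exists zs : nat -> R[i], [/\ forall k, zs k != 0,
    forall M : R, \forall k \near \oo, M <= normc (zs k) &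
    forall a, exists N, (m a <= count_mem a (mkseq zs N))%N].
Proof.
move=> m0 mN.
have /choice[s sP] (r : nat) : exists s : seq R[i], forall a,
    (a \in s) <-> [/\ m a != 0%N, r%:R <= normc a & normc a < r.+1%:R].
  have /finite_seqP[s sE] : finite_set
      [set a : R[i] | [/\ m a != 0%N, r%:R <= normc a & normc a < r.+1%:R]].
    apply: sub_finite_set (@locally_finite_disc R [set a | m a != 0%N] r.+1%:R _).
      by move=> a [ma _ /ltW ar].
    by move=> a; apply: filterS (mN a) => z /= ->.
  exists s => a; split=> [h|h].
    by have : [set` s] a by []; rewrite -sE.
  by have : [set` s] a by rewrite -sE.
(* The point [r + 1] keeps every list nonempty, so that no padding by zero
   projections is needed. *)
pose L r := flatten [seq nseq (m b) b | b <- s r] ++ [:: r.+1%:R : R[i]].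
have L0 r : L r != [::] by rewrite /L; case: (flatten _).
have LP r a : a \in L r -> a != 0 /\ r%:R <= normc a.
  rewrite mem_cat inE => /orP[/flattenP[t /mapP[b bs ->]]|/eqP ->].
    rewrite mem_nseq => /andP[_ /eqP ->]; have [mb rb _] := (sP r b).1 bs.
    by split=> //; apply: contraNneq mb => ->; rewrite m0.
  by rewrite pnatr_eq0 normc_nat ler_nat.
exists (concat_seq 0 L); split.
- by move=> k; have [i [_ /LP[]]] := @concat_seq_in _ 0 L L0 0 k (leq0n k).
- move=> M; exists (size (concat_below L (Num.truncn M).+1)) => // k /= hk.
  have [i [ri /LP[_]]] := concat_seq_in 0 L0 hk; apply: le_trans.
  apply: (le_trans (ltW (truncnS_gt M))); by rewrite ler_nat.
move=> a; have [->//|ma] := eqVneq (m a) 0%N; first by exists 0%N.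
(* The integer part of the modulus is the index of the annulus containing [a]. *)
have [N NP] := count_concat_seq 0 L0 a (Num.truncn (normc a)).
exists N; apply: leq_trans NP; rewrite /L count_cat.
apply: leq_trans (leq_addr _ _); apply: leq_count_flatten_nseq.
apply/sP; split=> //; last exact: truncnS_gt.
by rewrite truncn_le// normc_ge0.
Qed.

End Divisors.

(** * Clearing the poles of meromorphic functions *)

Section MeromorphicQuotients.
Context {R : realType}.
Implicit Types (a z : R[i]) (f g p : R[i] -> R[i]).

Lemma near_dnbhs_open a (P : set R[i]) :
  (\forall z \near a^', P z) -> \forall z \near a^', \forall w \near z, P w.
Proof.
move=> /dnbhs_normcP[e e0 eP]; apply/dnbhs_normcP; exists e => // z za ze.
have d0 : 0 < normc (z - a) by rewrite normc_gt0 subr_eq0.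
apply/nbhs_normcP; exists (Num.min (normc (z - a)) (e - normc (z - a))).
  by rewrite lt_min d0 subr_gt0.
move=> w; rewrite lt_min => /andP[wz we]; apply: eP.
  by apply: contraTneq wz => ->; rewrite normc_distC ltxx.
have -> : w - a = (w - z) + (z - a) by ring.
by apply: (le_lt_trans (ler_normcD _ _)); lra.
Qed.

Lemma derivableMc f g a : derivable f a 1 -> derivable g a 1 ->
  derivable (fun z => f z * g z) a 1.
Proof. by move=> /derivableP fa /derivableP ga; have [] := cderivM fa ga. Qed.

Lemma entire_subX a k z : derivable (fun w : R[i] => (w - a) ^+ k) z 1.
Proof.
have d := cderivD (cderiv_id z) (cderiv_cst z (- a)).
by case: (@cderiv_comp R z _ _ _ _ (cderivX (z - a) k) d).
Qed.

Lemma holomorphic_at_near f a : holomorphic_at f a ->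
  \forall z \near a, holomorphic_at f z.
Proof. exact: nbhs_interior. Qed.

(** At a pole [ord] is the exponent of the local quotient. That quotient is holomorphic off its
    centre, so the singular points are isolated. *)
Lemma meromorphic_order f : meromorphic f -> exists ord : R[i] -> nat,
  [/\ forall a, holomorphic_at f a -> ord a = 0%N,
    forall a, \forall z \near a^', holomorphic_at f z &
    forall a, exists2 g, holomorphic_at g a &
      \forall z \near a^', f z = g z / (z - a) ^+ ord a].
Proof.
move=> mf.
have /choice[ord ordP] a : exists k : nat, (holomorphic_at f a -> k = 0%N) /\
    exists2 g, holomorphic_at g a & \forall z \near a^', f z = g z / (z - a) ^+ k.
  have [ha|ha] := pselect (holomorphic_at f a).
    exists 0%N; split=> //; exists f => //.
    by apply: nearW => z; rewrite expr0 divr1.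
  have [//|[k [g [hg _ fg]]]] := mf a.
  exists k.+1; split=> [h|]; first by case: (ha h).
  exists g; [exact: hg|exact: fg].
exists ord; split=> [a|a|a]; [by case: (ordP a)| |by case: (ordP a)].
have [_ [g hg fg]] := ordP a.
have hg' : \forall z \near a^', holomorphic_at g z.
  by apply: nbhs_dnbhs; exact: holomorphic_at_near.
have neq : \forall z \near a^', z != a.
  by apply/dnbhs_normcP; exists 1.
have := near_dnbhs_open fg; have := near_dnbhs_open neq; move: hg'.
apply: filterS3 => z hgz hz fz.
(* Differentiating [f] at [w] takes the quotient formula on a whole neighbourhood of [w], hence the
   nested filter. *)
have : \forall w \near z, [/\ derivable g w 1, w != a &
    \forall w' \near w, f w' = g w' / (w' - a) ^+ ord a].
  have fz' := nbhs_interior fz; near=> w; split; near: w => //.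
apply: filterS => w [gw wa fw].
apply: near_eq_derivable (_ : derivable (fun v => g v / (v - a) ^+ ord a) w 1).
  by apply: filterS fw.
apply: derivableMc; first exact: gw.
have nz : (w - a) ^+ ord a != 0 by rewrite expf_neq0// subr_eq0.
apply: (derivableV (f := fun v => (v - a) ^+ ord a)); first exact: nz.
exact: entire_subX.
Unshelve. all: by end_near. Qed.

Lemma meromorphic_clear_poles f p (ord : R[i] -> nat) :
  (forall a, \forall z \near a^', holomorphic_at f z) ->
  (forall a, exists2 g, holomorphic_at g a &
    \forall z \near a^', f z = g z / (z - a) ^+ ord a) ->
  entire p ->
  (forall a, exists k q, [/\ (ord a <= k)%N, entire q &
    forall z, p z = (z - a) ^+ k * q z]) ->
  exists F, entire F /\ forall z, holomorphic_at f z -> F z = p z * f z.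
Proof.
move=> fN fg ep pq.
have /choice[h hP] a : exists h, derivable h a 1 /\
    \forall z \near a^', p z * f z = h z.
  have [g hg fgz] := fg a; have [k [q [ordk eq_ pE]]] := pq a.
  exists (fun z => (z - a) ^+ (k - ord a) * q z * g z); split.
    apply: derivableMc; last exact: nbhs_singleton hg.
    by apply: derivableMc; [exact: entire_subX|exact: eq_].
  have neq : \forall z \near a^', z != a by apply/dnbhs_normcP; exists 1.
  move: fgz neq; apply: filterS2 => z -> za.
  rewrite pE -{1}(subnK ordk) exprD.
  have nz : (z - a) ^+ ord a != 0 by rewrite expf_neq0// subr_eq0.
  by field.
(* The value of [f] at a pole is arbitrary, so there [F] takes the value of the local extension
   [h z] of the product at its own centre. *)
pose F z := if pselect (holomorphic_at f z) then p z * f z else h z z.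
have Fhol z : holomorphic_at f z -> F z = p z * f z.
  by move=> hz; rewrite /F; case: pselect => // nz; case: (nz hz).
have Fpole z : ~ holomorphic_at f z -> F z = h z z.
  by move=> nz; rewrite /F; case: pselect => // hz; case: (nz hz).
exists F; split=> [a|//].
have [ha|ha] := pselect (holomorphic_at f a).
  apply: near_eq_derivable (_ : derivable (fun v => p v * f v) a 1).
    by apply: filterS (holomorphic_at_near ha) => z /Fhol ->.
  by apply: derivableMc; [exact: ep|exact: nbhs_singleton ha].
have [dh ph] := hP a; apply: near_eq_derivable dh.
(* Around a pole [a] all other points are points of holomorphy, so [F] agrees with the
   differentiable function [h a] near [a]. *)
have /dnbhs_normcP[e e0 eP] : \forall z \near a^', h a z = F z.
  by move: (fN a) ph; apply: filterS2 => z /Fhol -> ->.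
apply/nbhs_normcP; exists e => // z ze.
have [->|za] := eqVneq z a; last exact: eP.
by rewrite Fpole.
Qed.

(** Each occurrence of [a] in the list contributes 1 - z / a, that is, (z - a) times the constant -
    1 / a; everything else goes into [q]. *)
Lemma canonical_terms_factor (zs : nat -> R[i]) a N :
  (forall k, zs k != 0) -> exists2 q, entire q &
    forall z, \prod_(0 <= j < N) canonical_term zs j z =
      (z - a) ^+ count_mem a (mkseq zs N) * q z.
Proof.
move=> zs0; elim: N => [|N [q eq_ qE]].
  exists (fun=> 1) => [z|z]; first by case: (cderiv_cst z 1).
  by rewrite big_geq// expr0 mulr1.
have dlog z : derivable (fun w : R[i] => cexp (log_part N.+1 (w / zs N))) z 1.
  have d := cderivM (cderiv_id z) (cderiv_cst z (zs N)^-1).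
  have d' := cderiv_comp (is_derive_log_part N.+1 _) d.
  by case: (cderiv_comp (is_derive_cexp _) d').
have [zNa|zNa] := eqVneq (zs N) a.
  exists (fun z => q z * (cexp (log_part N.+1 (z / zs N)) * (- (zs N)^-1))).
    move=> z; apply: derivableMc; first exact: eq_.
    apply: derivableMc; first exact: dlog.
    by case: (cderiv_cst z (- (zs N)^-1)).
  move=> z; rewrite mkseqS -cats1 count_cat big_nat_recr//= qE zNa eqxx.
  rewrite addn0 addn1 exprSr /canonical_term /weierstrass -zNa.
  by field.
exists (fun z => q z * canonical_term zs N z).
  move=> z; apply: derivableMc; first exact: eq_.
  by case: (is_derive_canonical_term zs N z).
move=> z; rewrite mkseqS -cats1 count_cat big_nat_recr//= qE (negbTE zNa).
by rewrite !addn0 mulrA.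
Qed.

(** A single product serves the whole family: its multiplicity at a point is at least the maximum of
    the orders, which still vanishes near every point, the point itself excepted, as the family is
    finite. *)
Lemma meromorphic_family_clear_poles (I : finType) (f : I -> R[i] -> R[i]) :
  (forall i, meromorphic (f i)) -> (forall i, holomorphic_at (f i) 0) ->
  exists (zs : nat -> R[i]) (p : R[i] -> R[i]),
    [/\ forall k, zs k != 0,
      forall M : R, \forall k \near \oo, M <= normc (zs k),
      forall z : R[i], exists d, is_derive z 1 p d,
      geometrically_close
        (fun k z => \prod_(0 <= j < k) canonical_term zs j z) (fun=> p) &
      forall i, exists F, entire F /\
        forall z, holomorphic_at (f i) z -> F z = p z * f i z].
Proof.
move=> mf hf; have /choice[ord ordP] i := meromorphic_order (mf i).
pose m a := \max_i ord i a.
have m0 : m 0 = 0%N.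
  by apply: big1 => i _; have [h _ _] := ordP i; exact/h/hf.
have mN (a : R[i]) : \forall z \near a^', m z = 0%N.
  have : \forall z \near a^', forall i, holomorphic_at (f i) z.
    by apply: filter_forall => i; case: (ordP i).
  apply: filterS => z hz; apply: big1 => i _.
  by have [h _ _] := ordP i; exact/h/hz.
have [zs [zs0 zsM zsm]] := divisor_sequence m0 mN.
have [p [dp pP psplit]] := weierstrass_product zsM.
exists zs, p; split=> // i; have [_ fN fg] := ordP i.
apply: (meromorphic_clear_poles fN fg).
  by move=> z; have [d []] := dp z.
move=> a; have [N Nm] := zsm a; have [q [dq pE]] := psplit N.
have [q' eq' q'E] := canonical_terms_factor a N zs0.
exists (count_mem a (mkseq zs N)), (fun z => q' z * q z); split.
- by apply: leq_trans Nm; exact: (@leq_bigmax _ (fun j => ord j a) i).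
- move=> z; apply: derivableMc; first exact: eq'.
  by have [d []] := dq z.
- by move=> z; rewrite pE q'E mulrA.
Qed.

End MeromorphicQuotients.

(** * One scalar multiplier for both matrices *)

Theorem theorem4p3 (R : realType) (n : nat) (A B : R[i] -> 'M[R[i]]_n)
    (mA : mx_meromorphic A) (mB : mx_meromorphic B)
    (hA : mx_holomorphic_at A 0) (hB : mx_holomorphic_at B 0)
    (dA : \det (A 0) != 0) (dB : \det (B 0) != 0) :
  exists P : R[i] -> 'M[R[i]]_n,
    canonical_product_form P /\
    exists At Bt : R[i] -> 'M[R[i]]_n,
      [/\ mx_entire At,
          mx_entire Bt,
          forall z, mx_holomorphic_at A z -> At z = P z *m A z &
          forall z, mx_holomorphic_at B z -> Bt z = P z *m B z].
Proof.
(* The boolean selects the matrix, so that all entries of [A] and [B] form one finite family with a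
   common multiplier. *)
pose f (x : bool * 'I_n * 'I_n) z := (if x.1.1 then A z else B z) x.1.2 x.2.
have mf x : meromorphic (f x) by case: x => -[[] i] j; [exact: mA|exact: mB].
have hf x : holomorphic_at (f x) 0 by case: x => -[[] i] j; [exact: hA|exact: hB].
have [zs [p [zs0 zsM dp pP fP]]] := meromorphic_family_clear_poles mf hf.
have [F FP] := choice fP.
exists (fun z => (p z)%:M); split; first exact: canonical_product_form_scalar.
exists (fun z => \matrix_(i, j) F (true, i, j) z),
  (fun z => \matrix_(i, j) F (false, i, j) z); split.
- move=> i j z; under eq_fun do rewrite mxE; exact: (FP (true, i, j)).1.
- move=> i j z; under eq_fun do rewrite mxE; exact: (FP (false, i, j)).1.
- move=> z hz; apply/matrixP => i j; rewrite mul_scalar_mx !mxE.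
  exact: (FP (true, i, j)).2 (hz i j).
- move=> z hz; apply/matrixP => i j; rewrite mul_scalar_mx !mxE.
  exact: (FP (false, i, j)).2 (hz i j).
Qed.
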